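(* The functor $E^{\mathbf{Bis}}\colon\mathbf{Bis}\to\mathbf{Chu}(\mathbf{Set},\mathbb R)$ defined by $$E^{\mathbf{Bis}}_0(X,F)=(X,\mathrm{ev}_{X,F},F),\qquad \mathrm{ev}_{X,F}\colon X\times F\to\mathbb R,\quad \mathrm{ev}_{X,F}(x,f)=f(x),$$ and, for a morphism $h\colon(X,F)\to(Y,G)$ of $\mathbf{Bis}$, $$E^{\mathbf{Bis}}_1(h)=(h,h^* )\colon(X,\mathrm{ev}_{X,F},F)\to(Y,\mathrm{ev}_{Y,G},G),\qquad h^*\colon G\to F,\quad h^*(g)=g\circ h,$$ is a strict Chu representation of $\mathbf{Bis}$ into $\mathbf{Chu}(\mathbf{Set},\mathbb R)$.
   Context: $\mathbf{Set}$ is the category of sets and functions in Bishop's sense (a set $X$ comes with an equality $=_X$, and functions respect equality). An embedding is a functor that is injective on objects and faithful; a representation is a full embedding; a Chu representation is a representation whose codomain is a Chu category; it is strict if it is injective on arrows. Objects of $\mathbf{Chu}(\mathbf{Set},\mathbb R)$ are triplets $(A,f,B)$ with $A,B$ sets and $f\colon A\times B\to\mathbb R$; a morphism $(A,f,B)\to(C,g,D)$ is a pair $(\phi^+,\phi^-)$ of functions $\phi^+\colon A\to C$, $\phi^-\colon D\to B$ with $f(a,\phi^-(d))=g(\phi^+(a),d)$ for all $a\in A$, $d\in D$; $(\theta^+,\theta^-)\circ(\phi^+,\phi^-)=(\theta^+\circ\phi^+,\phi^-\circ\theta^-)$, and identities are $(\mathrm{id}_A,\mathrm{id}_B)$. Bishop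 spaces: let $\mathbb F(X)$ be the set of functions $X\to\mathbb R$ (with pointwise equality) and $\overline a^X$ the constant function on $X$ with value $a\in\mathbb R$. $\mathrm{Bic}(\mathbb R)$ is the set of functions $\phi\colon\mathbb R\to\mathbb R$ that are uniformly continuous on every interval $[-n,n]$, $n\ge1$: for every $n\geq 1$ there is a modulus $\omega_{\phi,n}\colon\mathbb R^+\to\mathbb R^+$ such that $|x-y|<\omega_{\phi,n}(\epsilon)$ implies $|\phi(x)-\phi(y)|\le\epsilon$ for all $x,y\in[-n,n]$ and all $\epsilon>0$. For $\Phi\subseteq\mathbb F(X)$, its uniform closure is $\overline\Phi=\{f\in\mathbb F(X)\mid\forall\epsilon>0\ \exists g\in\Phi\ \forall x\in X\ |g(x)-f(x)|\le\epsilon\}$. A Bishop space is a pair $(X,F)$ with $F$ an extensional subset of $\mathbb F(X)$ (i.e. given by a property respecting the equality of $\mathbb F(X)$), called a Bishop topology, such that: $\overline a^X\in F$ for all $a\in\mathbb R$; $f,g\in F$ implies $f+g\in F$; $f\in F$ and $\phi\in\mathrm{Bic}(\mathbb R)$ imply $\phi\circ f\in F$; and $\overline F=F$. $\mathbf{Bis}$ is the category of Bishop spaces, in which a morphism $h\colon(X,F)\to(Y,G)$ is a function $h\colon X\to Y$ with $g\circ h\in F$ for every $g\in G$; composition and identities are those of functions. *)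

(* Defs.v *)
From Stdlib Require Export ConstructiveReals ConstructiveAbs.
From Stdlib Require Import QArith RelationClasses Eqdep Program.Equality.
From Stdlib Require Import FunctionalExtensionality PropExtensionality ProofIrrelevance.

Set Implicit Arguments.
Unset Strict Implicit.

Declare Scope bset_scope.
Delimit Scope bset_scope with bset.
Local Open Scope bset_scope.

(** * Sets and functions in Bishop's sense *)

Record bset : Type := BSet {
  carrier :> Type;
  eqs : carrier -> carrier -> Prop;
  eqs_equiv : Equivalence eqs }.
#[global] Existing Instance eqs_equiv.

Arguments eqs {b} _ _.
Notation "x ≈ y" := (eqs x y) (at level 70, no associativity) : bset_scope.

Record bfun (A B : bset) : Type := BFun {
  app :> A -> B;
  app_ext : forall x y : A, x ≈ y -> app x ≈ app y }.
Arguments BFun {A B} _ _.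
Arguments app_ext {A B} _ {x y} _.

Lemma funset_equiv (A B : bset) :
  Equivalence (fun f g : bfun A B => forall x, f x ≈ g x).
Proof.
  split.
  - intros f x; reflexivity.
  - intros f g H x; symmetry; apply H.
  - intros f g h H K x; transitivity (g x); auto.
Qed.

Definition funset (A B : bset) : bset :=
  {| carrier := bfun A B; eqs_equiv := funset_equiv A B |}.

Lemma prodset_equiv (A B : bset) :
  Equivalence (fun p q : A * B => fst p ≈ fst q /\ snd p ≈ snd q).
Proof.
  split.
  - intros p; split; reflexivity.
  - intros p q [H K]; split; symmetry; assumption.
  - intros p q r [H K] [H' K']; split; etransitivity; eassumption.
Qed.

Definition prodset (A B : bset) : bset :=
  {| carrier := (A * B)%type; eqs_equiv := prodset_equiv A B |}.

Record esubset (A : bset) : Type := ESubset {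
  mem :> A -> Prop;
  mem_ext : forall x y : A, x ≈ y -> mem x -> mem y }.
Arguments ESubset {A} _ _.
Arguments mem_ext {A} _ {x y} _ _.

Lemma subset_equiv (A : bset) (P : esubset A) :
  Equivalence (fun x y : {x : A | P x} => proj1_sig x ≈ proj1_sig y).
Proof.
  split.
  - intros x; reflexivity.
  - intros x y H; symmetry; exact H.
  - intros x y z H K; etransitivity; eassumption.
Qed.

Definition subset_bset (A : bset) (P : esubset A) : bset :=
  {| carrier := {x : A | P x}; eqs_equiv := subset_equiv P |}.

Definition bid (A : bset) : bfun A A := BFun (fun x => x) (fun x y H => H).

Definition bcomp (A B C : bset) (g : bfun B C) (f : bfun A B) : bfun A C :=
  BFun (fun x => g (f x)) (fun x y H => app_ext g (app_ext f H)).
Notation "g ∘ f" := (bcomp g f) (at level 40, left associativity) : bset_scope.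

(** Two sets are equal when they are identical ([=]).  Functions between equal
    sets are compared pointwise, and subsets of equal sets by extension; this is
    the convention behind all the equalities of objects and arrows below. *)
Inductive fun_eq (A B : bset) (f : bfun A B) :
  forall A' B' : bset, bfun A' B' -> Prop :=
| fun_eq_intro (g : bfun A B) : (forall x, f x ≈ g x) -> fun_eq f g.
Arguments fun_eq {A B} f {A' B'} _.

Lemma fun_eq_refl (A B : bset) (f : bfun A B) : fun_eq f f.
Proof. constructor; intros x; reflexivity. Qed.

Lemma fun_eq_sym (A B A' B' : bset) (f : bfun A B) (g : bfun A' B') :
  fun_eq f g -> fun_eq g f.
Proof. intros []; constructor; intros x; symmetry; auto. Qed.

Lemma fun_eq_trans (A B A' B' A'' B'' : bset)
    (f : bfun A B) (g : bfun A' B') (h : bfun A'' B'') :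
  fun_eq f g -> fun_eq g h -> fun_eq f h.
Proof. intros [g' H] []; constructor; intros x; etransitivity; eauto. Qed.

Lemma fun_eq_inv (A B : bset) (f g : bfun A B) :
  fun_eq f g -> forall x, f x ≈ g x.
Proof. intros H; dependent destruction H; assumption. Qed.

Lemma fun_eq_comp (A B C A' B' C' : bset) (f : bfun A B) (g : bfun B C)
    (f' : bfun A' B') (g' : bfun B' C') :
  fun_eq f f' -> fun_eq g g' -> fun_eq (g ∘ f) (g' ∘ f').
Proof.
  intros Hf; revert g'; destruct Hf as [f1 H]; intros g' K.
  dependent destruction K.
  constructor; intros x; simpl.
  transitivity (g (f1 x)); [apply app_ext, H | auto].
Qed.

(** * Categories whose objects and arrows both come with an equality *)

(** [hom_eq] is the equality of arrows; it compares arrows of arbitrary hom-sets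
    and forces equality of domains and of codomains.  [hom_retype] lets
    an arrow be composed across two equal objects: it is the identity arrow, typed
    with these objects as domain and codomain. *)
Record category : Type := Category {
  ob :> Type;
  ob_eq : ob -> ob -> Prop;
  hom : ob -> ob -> Type;
  hom_eq : forall a b c d : ob, hom a b -> hom c d -> Prop;
  idm : forall a : ob, hom a a;
  comp : forall a b c : ob, hom b c -> hom a b -> hom a c;
  ob_eq_equiv : Equivalence ob_eq;
  hom_eq_refl : forall (a b : ob) (f : hom a b), hom_eq f f;
  hom_eq_sym : forall (a b c d : ob) (f : hom a b) (g : hom c d),
      hom_eq f g -> hom_eq g f;
  hom_eq_trans : forall (a b c d e i : ob)
      (f : hom a b) (g : hom c d) (h : hom e i),
      hom_eq f g -> hom_eq g h -> hom_eq f h;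
  hom_eq_dom : forall (a b c d : ob) (f : hom a b) (g : hom c d),
      hom_eq f g -> ob_eq a c;
  hom_eq_cod : forall (a b c d : ob) (f : hom a b) (g : hom c d),
      hom_eq f g -> ob_eq b d;
  hom_retype : forall a b : ob, ob_eq a b ->
      exists i : hom a b, hom_eq i (idm a);
  idm_ext : forall a b : ob, ob_eq a b -> hom_eq (idm a) (idm b);
  comp_ext : forall (a b c a' b' c' : ob)
      (f : hom a b) (g : hom b c) (f' : hom a' b') (g' : hom b' c'),
      hom_eq f f' -> hom_eq g g' -> hom_eq (comp g f) (comp g' f');
  comp_idl : forall (a b : ob) (f : hom a b), hom_eq (comp (idm b) f) f;
  comp_idr : forall (a b : ob) (f : hom a b), hom_eq (comp f (idm a)) f;
  comp_assoc : forall (a b c d : ob) (f : hom a b) (g : hom b c) (h : hom c d),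
      hom_eq (comp h (comp g f)) (comp (comp h g) f) }.

Arguments ob_eq {c} _ _ : rename.
Arguments hom {c} _ _ : rename.
Arguments hom_eq {c a b c0 d} _ _ : rename.
Arguments idm {c} a : rename.
Arguments comp {c a b c0} _ _ : rename.

(** Preservation of [ob_eq] follows from [fmap_ext] and [fmap_id]
    (lemma [fob_ext]). *)
Record functor (C D : category) : Type := Functor {
  fob :> C -> D;
  fmap : forall a b : C, hom a b -> hom (fob a) (fob b);
  fmap_ext : forall (a b c d : C) (f : hom a b) (g : hom c d),
      hom_eq f g -> hom_eq (fmap f) (fmap g);
  fmap_id : forall a : C, hom_eq (fmap (idm a)) (idm (fob a));
  fmap_comp : forall (a b c : C) (f : hom a b) (g : hom b c),
      hom_eq (fmap (comp g f)) (comp (fmap g) (fmap f)) }.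
Arguments fmap {C D} _ {a b} _.

Lemma fob_ext (C D : category) (F : functor C D) (a b : C) :
  ob_eq a b -> ob_eq (F a) (F b).
Proof.
  intros H.
  apply (@hom_eq_dom D _ _ _ _ (idm (F a)) (idm (F b))).
  eapply hom_eq_trans; [apply hom_eq_sym, fmap_id |].
  eapply hom_eq_trans; [apply fmap_ext, idm_ext, H | apply fmap_id].
Qed.

Section FunctorProperties.
Context {C D : category} (F : functor C D).

Definition injective_on_objects : Prop :=
  forall a b : C, ob_eq (F a) (F b) -> ob_eq a b.

Definition faithful : Prop :=
  forall (a b : C) (f g : hom a b), hom_eq (fmap F f) (fmap F g) -> hom_eq f g.

Definition full : Prop :=
  forall (a b : C) (k : hom (F a) (F b)), exists f : hom a b, hom_eq (fmap F f) k.

Definition injective_on_arrows : Prop :=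
  forall (a b c d : C) (f : hom a b) (g : hom c d),
    hom_eq (fmap F f) (fmap F g) -> hom_eq f g.

Definition embedding : Prop := injective_on_objects /\ faithful.

Definition representation : Prop := embedding /\ full.

End FunctorProperties.

(** * The category Chu(Set, K) *)

Section Chu.
Variable K : bset.

Record chu_ob : Type := ChuOb {
  chu_pos : bset;
  chu_neg : bset;
  chu_fun : bfun (prodset chu_pos chu_neg) K }.

Inductive chu_ob_eq : chu_ob -> chu_ob -> Prop :=
| chu_ob_eq_intro (A B : bset) (f g : bfun (prodset A B) K) :
    (forall p, f p ≈ g p) -> chu_ob_eq (ChuOb f) (ChuOb g).

Record chu_hom (P Q : chu_ob) : Type := ChuHom {
  hom_pos : bfun (chu_pos P) (chu_pos Q);
  hom_neg : bfun (chu_neg Q) (chu_neg P);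
  chu_adj : forall (a : chu_pos P) (d : chu_neg Q),
      chu_fun P (a, hom_neg d) ≈ chu_fun Q (hom_pos a, d) }.

Definition chu_hom_eq (P Q P' Q' : chu_ob)
    (u : chu_hom P Q) (v : chu_hom P' Q') : Prop :=
  chu_ob_eq P P' /\ chu_ob_eq Q Q' /\
  fun_eq (hom_pos u) (hom_pos v) /\ fun_eq (hom_neg u) (hom_neg v).

Definition chu_id (P : chu_ob) : chu_hom P P.
Proof.
  refine {| hom_pos := bid (chu_pos P); hom_neg := bid (chu_neg P) |}.
  intros a d; reflexivity.
Defined.

Definition chu_comp (P Q S : chu_ob) (v : chu_hom Q S) (u : chu_hom P Q) :
  chu_hom P S.
Proof.
  refine {| hom_pos := hom_pos v ∘ hom_pos u; hom_neg := hom_neg u ∘ hom_neg v |}.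
  intros a d; simpl.
  transitivity (chu_fun Q (hom_pos u a, hom_neg v d)); apply chu_adj.
Defined.

#[global] Instance chu_ob_eq_equiv : Equivalence chu_ob_eq.
Proof.
  split.
  - intros [A B f]; constructor; intros p; reflexivity.
  - intros P Q []; constructor; intros p; symmetry; auto.
  - intros P Q S [A B f g H] HQ; dependent destruction HQ.
    constructor; intros p; etransitivity; eauto.
Qed.

Lemma chu_hom_eq_refl (P Q : chu_ob) (u : chu_hom P Q) : chu_hom_eq u u.
Proof.
  repeat split; solve [reflexivity | apply fun_eq_refl].
Qed.

Lemma chu_hom_eq_sym (P Q P' Q' : chu_ob)
    (u : chu_hom P Q) (v : chu_hom P' Q') : chu_hom_eq u v -> chu_hom_eq v u.
Proof.
  intros (? & ? & ? & ?).
  repeat split; solve [symmetry; assumption | apply fun_eq_sym; assumption].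
Qed.

Lemma chu_hom_eq_trans (P Q P' Q' P'' Q'' : chu_ob)
    (u : chu_hom P Q) (v : chu_hom P' Q') (w : chu_hom P'' Q'') :
  chu_hom_eq u v -> chu_hom_eq v w -> chu_hom_eq u w.
Proof.
  intros (? & ? & ? & ?) (? & ? & ? & ?).
  repeat split; solve [etransitivity; eassumption | eapply fun_eq_trans; eassumption].
Qed.

Lemma chu_retype (P Q : chu_ob) :
  chu_ob_eq P Q -> exists i : chu_hom P Q, chu_hom_eq i (chu_id P).
Proof.
  intros [A B f g H].
  unshelve eexists (@ChuHom (ChuOb f) (ChuOb g) (bid A) (bid B) _).
  - intros a d; apply H.
  - split; [reflexivity | split; [| split; apply fun_eq_refl]].
    constructor; intros p; symmetry; auto.
Qed.

Lemma chu_id_ext (P Q : chu_ob) :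
  chu_ob_eq P Q -> chu_hom_eq (chu_id P) (chu_id Q).
Proof.
  intros H; repeat split; auto; destruct H; apply fun_eq_refl.
Qed.

Lemma chu_comp_ext (P Q S P' Q' S' : chu_ob)
    (u : chu_hom P Q) (v : chu_hom Q S) (u' : chu_hom P' Q') (v' : chu_hom Q' S') :
  chu_hom_eq u u' -> chu_hom_eq v v' ->
  chu_hom_eq (chu_comp v u) (chu_comp v' u').
Proof.
  intros (? & ? & ? & ?) (? & ? & ? & ?).
  repeat split; simpl; auto using fun_eq_comp.
Qed.

Definition Chu : category.
Proof.
  refine {|
    ob := chu_ob; ob_eq := chu_ob_eq; hom := chu_hom; hom_eq := chu_hom_eq;
    idm := chu_id; comp := chu_comp;
    ob_eq_equiv := chu_ob_eq_equiv;
    hom_eq_refl := chu_hom_eq_refl;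
    hom_eq_sym := chu_hom_eq_sym;
    hom_eq_trans := chu_hom_eq_trans;
    hom_eq_dom := fun _ _ _ _ _ _ H => proj1 H;
    hom_eq_cod := fun _ _ _ _ _ _ H => proj1 (proj2 H);
    hom_retype := chu_retype;
    idm_ext := chu_id_ext;
    comp_ext := chu_comp_ext |};
  intros; repeat split; simpl;
  solve [reflexivity | constructor; intros x; reflexivity].
Defined.

End Chu.

Definition chu_representation (C : category) (K : bset)
    (E : functor C (Chu K)) : Prop := representation E.

Definition strict_chu_representation (C : category) (K : bset)
    (E : functor C (Chu K)) : Prop :=
  chu_representation E /\ injective_on_arrows E.

(** * Bishop spaces *)

(** [R] is an arbitrary implementation of the constructive reals; these include
    the Cauchy reals and the classical reals. *)
Section Bishop.
Variable R : ConstructiveReals.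
Local Open Scope ConstructiveReals.

Lemma CReq_equiv : Equivalence (CReq R).
Proof.
  split.
  - intros x; apply CReq_refl.
  - intros x y; apply CReq_sym.
  - intros x y z; apply CReq_trans.
Qed.

Definition Rset : bset := {| carrier := CRcarrier R; eqs_equiv := CReq_equiv |}.

(** [CRltProp] is the [Prop]-valued version of the [Set]-valued order [CRlt]. *)
Lemma CRltProp_ext (x y : Rset) : x ≈ y -> CRltProp R 0 x -> CRltProp R 0 y.
Proof.
  intros H Hx; apply CRltForget.
  apply CRlt_le_trans with x; [apply CRltEpsilon, Hx | apply H].
Qed.

Definition Rpos : bset := subset_bset (@ESubset Rset (CRltProp R 0) CRltProp_ext).

Definition Fset (X : bset) : bset := funset X Rset.

Definition constf (X : bset) (a : Rset) : Fset X :=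
  @BFun X Rset (fun _ => a) (fun _ _ _ => CReq_refl a).

Lemma addf_ext (X : bset) (f g : Fset X) (x y : X) :
  x ≈ y -> CReq R (f x + g x) (f y + g y).
Proof.
  intros H; apply CRplus_morph; [exact (app_ext f H) | exact (app_ext g H)].
Qed.

Definition addf (X : bset) (f g : Fset X) : Fset X :=
  @BFun X Rset (fun x => f x + g x) (@addf_ext X f g).

Definition in_interval (n : nat) (x : Rset) : Prop :=
  - CR_of_Q R (inject_Z (Z.of_nat n)) <= x <= CR_of_Q R (inject_Z (Z.of_nat n)).

Definition modulus_on (phi : bfun Rset Rset) (n : nat) (w : bfun Rpos Rpos) : Prop :=
  forall (x y : Rset) (e : Rpos), in_interval n x -> in_interval n y ->
    CRabs R (x - y) < proj1_sig (w e) ->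
    CRabs R (phi x - phi y) <= proj1_sig e.

Definition Bic (phi : bfun Rset Rset) : Prop :=
  forall n : nat, (1 <= n)%nat -> exists w : bfun Rpos Rpos, modulus_on phi n w.

Definition uniform_closure (X : bset) (Phi : esubset (Fset X)) (f : Fset X) : Prop :=
  forall e : Rpos, exists g : Fset X, Phi g /\
    forall x : X, CRabs R (g x - f x) <= proj1_sig e.

Record bishop_topology (X : bset) (F : esubset (Fset X)) : Prop := {
  bt_const : forall a : Rset, F (constf X a);
  bt_add : forall f g : Fset X, F f -> F g -> F (addf f g);
  bt_bic : forall (f : Fset X) (phi : bfun Rset Rset),
      F f -> Bic phi -> F (phi ∘ f);
  bt_closure : forall f : Fset X, uniform_closure F f <-> F f }.

Record bishop_space : Type := BishopSpace {
  points : bset;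
  topology : esubset (Fset points);
  topology_axioms : bishop_topology topology }.

Inductive bis_ob_eq : bishop_space -> bishop_space -> Prop :=
| bis_ob_eq_intro (X : bset) (F G : esubset (Fset X))
    (HF : bishop_topology F) (HG : bishop_topology G) :
    (forall f : Fset X, F f <-> G f) ->
    bis_ob_eq (BishopSpace HF) (BishopSpace HG).

Record bis_hom (S T : bishop_space) : Type := BisHom {
  bis_fun :> bfun (points S) (points T);
  bis_mor : forall g : Fset (points T), topology T g -> topology S (g ∘ bis_fun) }.

Definition bis_hom_eq (S T S' T' : bishop_space)
    (h : bis_hom S T) (k : bis_hom S' T') : Prop :=
  bis_ob_eq S S' /\ bis_ob_eq T T' /\ fun_eq h k.

Definition bis_id (S : bishop_space) : bis_hom S S.
Proof.
  refine {| bis_fun := bid (points S) |}.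
  intros g Hg; apply (mem_ext (topology S) (x := g)); [| exact Hg].
  intros x; apply CReq_refl.
Defined.

Definition bis_comp (S T U : bishop_space) (k : bis_hom T U) (h : bis_hom S T) :
  bis_hom S U.
Proof.
  refine {| bis_fun := k ∘ h |}.
  intros g Hg; exact (bis_mor h (bis_mor k Hg)).
Defined.

#[global] Instance bis_ob_eq_equiv : Equivalence bis_ob_eq.
Proof.
  split.
  - intros [X F HF]; constructor; tauto.
  - intros S T []; constructor; intros f; symmetry; auto.
  - intros S T U [X F G HF HG H] HU; dependent destruction HU.
    constructor; intros f; etransitivity; eauto.
Qed.

(** Extensional subsets with the same elements are identical by extensionality,
    so that the sets [F] and [G] are identical whenever [(X, F)] and [(X, G)] are
    equal; this is what makes the functor below respect equality of objects. *)
Lemma bis_ob_eq_eq (S T : bishop_space) : bis_ob_eq S T -> S = T.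
Proof.
  intros [X [F eF] [G eG] HF HG H]; simpl in H.
  assert (F = G) as <-.
  { apply functional_extensionality; intros f.
    apply propositional_extensionality, H. }
  destruct (proof_irrelevance _ eF eG).
  destruct (proof_irrelevance _ HF HG).
  reflexivity.
Qed.

Lemma bis_hom_eq_refl (S T : bishop_space) (h : bis_hom S T) : bis_hom_eq h h.
Proof.
  repeat split; solve [reflexivity | apply fun_eq_refl].
Qed.

Lemma bis_hom_eq_sym (S T S' T' : bishop_space)
    (h : bis_hom S T) (k : bis_hom S' T') : bis_hom_eq h k -> bis_hom_eq k h.
Proof.
  intros (? & ? & ?).
  repeat split; solve [symmetry; assumption | apply fun_eq_sym; assumption].
Qed.

Lemma bis_hom_eq_trans (S T S' T' S'' T'' : bishop_space)
    (h : bis_hom S T) (k : bis_hom S' T') (l : bis_hom S'' T'') :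
  bis_hom_eq h k -> bis_hom_eq k l -> bis_hom_eq h l.
Proof.
  intros (? & ? & ?) (? & ? & ?).
  repeat split; solve [etransitivity; eassumption | eapply fun_eq_trans; eassumption].
Qed.

Lemma bis_retype (S T : bishop_space) :
  bis_ob_eq S T -> exists i : bis_hom S T, bis_hom_eq i (bis_id S).
Proof.
  intros H; destruct (bis_ob_eq_eq H).
  exists (bis_id S); apply bis_hom_eq_refl.
Qed.

Lemma bis_id_ext (S T : bishop_space) :
  bis_ob_eq S T -> bis_hom_eq (bis_id S) (bis_id T).
Proof.
  intros H; destruct (bis_ob_eq_eq H); apply bis_hom_eq_refl.
Qed.

Lemma bis_comp_ext (S T U S' T' U' : bishop_space)
    (h : bis_hom S T) (k : bis_hom T U) (h' : bis_hom S' T') (k' : bis_hom T' U') :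
  bis_hom_eq h h' -> bis_hom_eq k k' ->
  bis_hom_eq (bis_comp k h) (bis_comp k' h').
Proof.
  intros (? & ? & ?) (? & ? & ?).
  repeat split; simpl; auto using fun_eq_comp.
Qed.

Definition Bis : category.
Proof.
  refine {|
    ob := bishop_space; ob_eq := bis_ob_eq; hom := bis_hom; hom_eq := bis_hom_eq;
    idm := bis_id; comp := bis_comp;
    ob_eq_equiv := bis_ob_eq_equiv;
    hom_eq_refl := bis_hom_eq_refl;
    hom_eq_sym := bis_hom_eq_sym;
    hom_eq_trans := bis_hom_eq_trans;
    hom_eq_dom := fun _ _ _ _ _ _ H => proj1 H;
    hom_eq_cod := fun _ _ _ _ _ _ H => proj1 (proj2 H);
    hom_retype := bis_retype;
    idm_ext := bis_id_ext;
    comp_ext := bis_comp_ext |};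
  intros; repeat split; simpl;
  solve [reflexivity | constructor; intros x; reflexivity].
Defined.

(** * The functor from Bis to Chu(Set, R) *)

Definition opens (S : bishop_space) : bset := subset_bset (topology S).

Lemma ev_ext (S : bishop_space) (p q : prodset (points S) (opens S)) :
  p ≈ q -> (proj1_sig (snd p) (fst p) : Rset) ≈ proj1_sig (snd q) (fst q).
Proof.
  intros [H K]; transitivity (proj1_sig (snd p) (fst q)).
  - apply app_ext, H.
  - apply K.
Qed.

Definition ev (S : bishop_space) : bfun (prodset (points S) (opens S)) Rset :=
  @BFun (prodset (points S) (opens S)) Rset
    (fun p => proj1_sig (snd p) (fst p)) (@ev_ext S).

Lemma pullback_ext (S T : bishop_space) (h : bis_hom S T) (g g' : opens T) :
  g ≈ g' -> (proj1_sig g ∘ h : Fset (points S)) ≈ proj1_sig g' ∘ h.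
Proof. intros H x; exact (H (h x)). Qed.

Definition pullback (S T : bishop_space) (h : bis_hom S T) :
  bfun (opens T) (opens S) :=
  @BFun (opens T) (opens S)
    (fun g => exist _ (proj1_sig g ∘ h) (bis_mor h (proj2_sig g)))
    (@pullback_ext S T h).

Definition EBis0 (S : bishop_space) : chu_ob Rset := ChuOb (ev S).

Definition EBis1 (S T : bishop_space) (h : bis_hom S T) :
  chu_hom (EBis0 S) (EBis0 T) :=
  {| hom_pos := h : bfun (chu_pos (EBis0 S)) (chu_pos (EBis0 T));
     hom_neg := pullback h : bfun (chu_neg (EBis0 T)) (chu_neg (EBis0 S));
     chu_adj := fun x g => CReq_refl (proj1_sig g (h x)) |}.

Lemma EBis1_ext (S T S' T' : bishop_space)
    (h : bis_hom S T) (k : bis_hom S' T') :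
  bis_hom_eq h k -> chu_hom_eq (EBis1 h) (EBis1 k).
Proof.
  intros (HS & HT & H).
  destruct (bis_ob_eq_eq HS), (bis_ob_eq_eq HT).
  split; [reflexivity | split; [reflexivity | split; [exact H |]]].
  constructor; intros g x.
  exact (app_ext (proj1_sig g) (fun_eq_inv H x)).
Qed.

Definition EBis : functor Bis (Chu Rset).
Proof.
  refine (@Functor Bis (Chu Rset) EBis0 EBis1 EBis1_ext _ _);
  intros; (split; [reflexivity | split; [reflexivity | split]]);
  constructor; intros x; try reflexivity; intros y; reflexivity.
Defined.

End Bishop.

(* Main.v *)
Require Import Defs.
From Stdlib Require Import ConstructiveReals.

Local Open Scope bset_scope.

(** The Chu space of a Bishop space [(X, F)] has the evaluation map as its
    matrix, so each element [f] of the second component is determined by its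
    row [x |-> f x].  Everything follows from this.

    Injectivity on objects ([EBis_injective_on_objects]): an equality of Chu
    spaces identifies the carriers [X] and the sets underlying [F] and [G], and
    it also identifies the evaluations.  The former alone does not say that [F]
    and [G] have the same elements, because the identification of the two
    subsets need not commute with their inclusions into the set of functions;
    the agreement of the evaluations is what forces it to.

    Fullness ([EBis_full]): for a Chu morphism [(h, k)], adjointness reads
    [k g x = g (h x)].  Hence [g ∘ h] equals [k g], which lies in [F], so that
    [h] is a morphism of Bishop spaces and [k] is pullback along [h].

    Injectivity on arrows is then immediate: the positive component of
    [EBis1 h] is [h] itself, and its domain and codomain are recovered by
    injectivity on objects.  Faithfulness is a special case. *)

(** Eliminating [chu_ob_eq] directly is blocked when the components of both Chu
    spaces are specific sets, as for [EBis0].  Here they are compared along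
    explicit identities, of which one can be eliminated and the other kept as
    an opaque cast. *)
Lemma chu_ob_eq_cast (K : bset) (P Q : chu_ob K) :
  chu_ob_eq P Q ->
  exists (eA : chu_pos P = chu_pos Q) (eB : chu_neg P = chu_neg Q),
  forall (a : chu_pos P) (b : chu_neg P),
    chu_fun P (a, b) ≈
    chu_fun Q (eq_rect _ carrier a _ eA, eq_rect _ carrier b _ eB).
Proof.
  intros [A B f g H]; exists eq_refl, eq_refl.
  intros a b; apply H.
Qed.

(** An element [f] of [F], cast to an element of [G], is a function in [G] that
    has the same values as [f]; so [f] lies in [G] by extensionality.  The other
    inclusion is the same argument for the inverse cast. *)
Lemma subset_ext_of_cast (A B : bset) (F G : esubset (funset A B))
    (e : subset_bset F = subset_bset G) :
  (forall (x : A) (f : subset_bset F),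
      proj1_sig f x ≈ proj1_sig (eq_rect _ carrier f _ e : subset_bset G) x) ->
  forall f : funset A B, F f <-> G f.
Proof.
  intros H f; split; intros Hf.
  - pose (g := eq_rect _ carrier (exist _ f Hf : subset_bset F) _ e
               : subset_bset G).
    apply (mem_ext G (x := proj1_sig g)); [| exact (proj2_sig g)].
    intros x; symmetry; exact (H x (exist _ f Hf)).
  - pose (g := eq_rect _ carrier (exist _ f Hf : subset_bset G) _ (eq_sym e)
               : subset_bset F).
    apply (mem_ext F (x := proj1_sig g)); [| exact (proj2_sig g)].
    assert (eg : eq_rect _ carrier g _ e = exist _ f Hf) by apply rew_opp_r.
    intros x; pose proof (H x g) as Hx; rewrite eg in Hx; exact Hx.
Qed.

Lemma EBis_injective_on_objects (R : ConstructiveReals) :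
  injective_on_objects (EBis R).
Proof.
  intros [X F HF] [Y G HG] H.
  destruct (chu_ob_eq_cast _ _ _ H) as (eA & eB & HE).
  cbn in eA; destruct eA.
  constructor; exact (subset_ext_of_cast X (Rset R) F G eB HE).
Qed.

Lemma EBis_injective_on_arrows (R : ConstructiveReals) :
  injective_on_arrows (EBis R).
Proof.
  intros S T S' T' h k (HS & HT & Hpos & _).
  exact (conj (EBis_injective_on_objects R S S' HS)
           (conj (EBis_injective_on_objects R T T' HT) Hpos)).
Qed.

Lemma EBis_full (R : ConstructiveReals) : full (EBis R).
Proof.
  intros S T [h k adj]; cbn in h, k, adj.
  assert (mor : forall g : Fset R (points T), topology T g -> topology S (g ∘ h)).
  { intros g Hg.
    apply (mem_ext (topology S) (x := proj1_sig (k (exist _ g Hg))));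
      [| exact (proj2_sig (k (exist _ g Hg)))].
    intros x; exact (adj x (exist _ g Hg)). }
  exists (BisHom mor).
  split; [reflexivity | split; [reflexivity | split]].
  - apply fun_eq_refl.
  - constructor; intros g x; symmetry; exact (adj x g).
Qed.

Theorem proposition5p5 (R : ConstructiveReals) :
  strict_chu_representation (EBis R).
Proof.
  split; [| apply EBis_injective_on_arrows].
  split; [split |].
  - apply EBis_injective_on_objects.
  - intros S T h k; apply EBis_injective_on_arrows.
  - apply EBis_full.
Qed.
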